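(* Let $X$ be an infinite-dimensional complex Hilbert space with open unit ball $B_X$ and orthonormal basis $(e_k)_{k\in\Gamma}$, let $Y$ be a complex Banach space, let $\mu$ be a normal weight on $B_X$, and let $f\in H(B_X,Y)$. The following are equivalent: (1) $f\in\mathcal{B}_\mu^\nabla(B_X,Y)$; (2) $\sup\{\|f_F\|_{\mathcal{B}_\mu^\nabla(\mathbb{B}_{[F]},Y)}:\ F\subset\Gamma,\ |F|<\infty\}<\infty$; (3) $\sup_{x\in OS_m}\|f_x\|_{\mathcal{B}_\mu^\nabla(\mathbb{B}_m,Y)}<\infty$ for every $m\ge2$; (4) there exists $m\ge2$ such that $\sup_{x\in OS_m}\|f_x\|_{\mathcal{B}_\mu^\nabla(\mathbb{B}_m,Y)}<\infty$. Moreover, for each $m\ge2$, $$\|f\|_{s\mathcal{B}_\mu^\nabla(B_X,Y)}=\sup_{|F|<\infty}\|f_F\|_{s\mathcal{B}_\mu^\nabla(\mathbb{B}_{[F]},Y)}=\sup_{x\in OS_m}\|f_x\|_{s\mathcal{B}_\mu^\nabla(\mathbb{B}_m,Y)}.$$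
   Context: A positive continuous function $\mu$ on $[0,1)$ is normal if there are constants $0\le\delta<1$ and $0<a<b<\infty$ such that $\mu(t)/(1-t)^a$ is decreasing on $[\delta,1)$ with limit $0$ as $t\to1$, and $\mu(t)/(1-t)^b$ is increasing on $[\delta,1)$ with limit $\infty$ as $t\to1$. A normal weight on $B_X$ is $\mu(z)=\mu(\|z\|)$ for such a function; the same formula defines the weight on the unit balls of $\mathbb{C}^m$ and of finite-dimensional subspaces. $H(B_X,Y)$ is the space of $Y$-valued holomorphic functions on $B_X$. For a scalar holomorphic function $h$, $\nabla h(z)=(\partial h/\partial z_k(z))_{k}$ is the element with $h'(z)(x)=\langle x,\overline{\nabla h(z)}\rangle$, where $\overline{z}=\sum_k\overline{z_k}e_k$. For $f\in H(B_X,Y)$, $\|\nabla f(z)\|=\sup_{u\in Y',\|u\|=1}\|\nabla(u\circ f)(z)\|$. Put $\|f\|_{s\mathcal{B}_\mu^\nabla(B_X,Y)}=\sup_{z\in B_X}\mu(z)\|\nabla f(z)\|$, let $\mathcal{B}_\mu^\nabla(B_X,Y)$ be the set of $f\in H(B_X,Y)$ for which this is finite, and $\|f\|_{\mathcal{B}_\mu^\nabla(B_X,Y)}=\|f(0)\|+\|f\|_{s\mathcal{B}_\mu^\nabla(B_X,Y)}$. The same definitions are used with $B_X$ replaced by $\mathbb{B}_m$, the open unit ball of $\mathbb{C}^m$, or by $\mathbb{B}_{[F]}$, the open unit ball of $\mathrm{span}\{e_k:k\in F\}$, for finite $F\subset\Gamma$. $OS_m=\{x=(x_1,\dots,x_m):x_k\in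 X,\ \langle x_k,x_j\rangle=\delta_{kj}\}$ is the family of orthonormal systems of order $m$. For $x\in OS_m$, $f_x(z_1,\dots,z_m)=f\big(\sum_{k=1}^m z_kx_k\big)$ on $\mathbb{B}_m$. For finite $F\subset\Gamma$, $f_F$ is the corresponding function for the orthonormal system $\{e_k:k\in F\}$, i.e. $f_F$ is the restriction of $f$ to $\mathbb{B}_{[F]}$. *)

(* Defs.v *)
From HB Require Import structures.
From mathcomp Require Import all_boot all_order all_algebra.
From mathcomp Require Import sesquilinear spectral finmap complex.
From mathcomp Require Import all_classical all_reals all_analysis.

Set Implicit Arguments.
Unset Strict Implicit.
Unset Printing Implicit Defensive.

Import Order.TTheory GRing.Theory Num.Theory.
Import numFieldNormedType.Exports.

Local Open Scope classical_set_scope.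
Local Open Scope ring_scope.

(* Norms over R[i] take their values in R[i]; [rnorm] is the same number in R. *)
Definition rnorm (R : realType) (V : normedModType R[i]) (x : V) : R :=
  complex.Re `|x|.

(* Monotonicity is understood in the wide sense.  Strict monotonicity defines
   the same class of weights: shrink a and enlarge b. *)
Definition normal_weight (R : realType) (mu : R -> R) : Prop :=
  [/\ forall t, 0 <= t < 1 -> 0 < mu t,
      {within `[0, 1[, continuous mu}
    & exists delta a b : R,
      [/\ 0 <= delta < 1, 0 < a < b,
          {in `[delta, 1[ &, nonincreasing_fun (fun t => mu t / (1 - t) `^ a)}
            /\ mu t / (1 - t) `^ a @[t --> 1^'-] --> 0
        & {in `[delta, 1[ &, nondecreasing_fun (fun t => mu t / (1 - t) `^ b)}
            /\ mu t / (1 - t) `^ b @[t --> 1^'-] --> +oo]].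

(* C^m with the Euclidean norm; the norm that the library puts on row vectors
   is the sup norm. *)
Definition euclid (R : realType) (m : nat) : Type := 'rV[R[i]]_m.

Section Euclid.
Variables (R : realType) (m : nat).

HB.instance Definition _ := GRing.Lmodule.on (euclid R m).

Definition euclid_dot (x y : euclid R m) : R[i] := dotmx x y.

Definition euclid_norm (x : euclid R m) : R[i] := sqrtC (euclid_dot x x).

Definition euclid_basis (k : 'I_m) : euclid R m := delta_mx 0 k.

Lemma euclid_ler_normD (x y : euclid R m) :
  euclid_norm (x + y) <= euclid_norm x + euclid_norm y.
Proof. by rewrite (triangle_lerif (@dotmx R[i] m) x y). Qed.

Lemma euclid_normrZ (a : R[i]) (x : euclid R m) :
  euclid_norm (a *: x) = `|a| * euclid_norm x.
Proof.
rewrite /euclid_norm /euclid_dot (dnormZ (@dotmx R[i] m)).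
by rewrite sqrtCM ?nnegrE ?exprn_ge0 ?dnorm_ge0// sqrCK.
Qed.

Lemma euclid_normr0_eq0 (x : euclid R m) : euclid_norm x = 0 -> x = 0.
Proof.
by move=> /eqP; rewrite (sqrt_dnorm_eq0 (@dotmx R[i] m)) => /eqP.
Qed.

HB.instance Definition _ := Lmodule_isNormed.Build R[i] (euclid R m)
  euclid_ler_normD euclid_normrZ euclid_normr0_eq0.

End Euclid.

Arguments euclid_basis {R m} k.

Definition finspan (C : numFieldType) (X : lmodType C) (I : choiceType)
    (e : I -> X) (F : {fset I}) : set X :=
  [set v | exists c : I -> C, v = \sum_(k <- F) c k *: e k].

Definition orthonormal_family (C : numFieldType) (X : lmodType C)
    (dot : X -> X -> C) (I : eqType) (e : I -> X) : Prop :=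
  forall k j, dot (e k) (e j) = (k == j)%:R.

Definition orthonormal_basis (C : numFieldType) (X : normedModType C)
    (dot : X -> X -> C) (I : choiceType) (e : I -> X) : Prop :=
  orthonormal_family dot e /\
  closure (\bigcup_(F in [set: {fset I}]) finspan e F) = setT.

Definition infinite_dimensional (C : numFieldType) (X : lmodType C) : Prop :=
  forall (n : nat) (b : 'I_n -> X),
  exists x : X, forall c : 'I_n -> C, x <> \sum_(i < n) c i *: b i.

Section FinSpan.
Variables (R : realType) (X : normedModType R[i]) (I : choiceType).
Variables (e : I -> X) (F : {fset I}).

Definition finspan_pred : {pred X} := fun v => `[< finspan e F v >].

Lemma finspan_submod : submod_closed finspan_pred.
Proof.
split; first by apply/asboolP; exists (fun=> 0); rewrite big1// => k _; rewrite scale0r.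
move=> a _ _ /asboolP[c ->] /asboolP[d ->]; apply/asboolP.
exists (fun k => a * c k + d k).
rewrite scaler_sumr -big_split/=; apply: eq_bigr => k _.
by rewrite scalerDl scalerA.
Qed.

HB.instance Definition _ :=
  GRing.isSubmodClosed.Build R[i] X finspan_pred finspan_submod.

(* span {e_k : k \in F} as a normed space, with the norm of X *)
Record subspan : Type :=
  Subspan { subspan_val : X ; subspan_valP : subspan_val \in finspan_pred }.

HB.instance Definition _ := [isSub for subspan_val].
HB.instance Definition _ := [Choice of subspan by <:].
HB.instance Definition _ :=
  [SubChoice_isSubLmodule of subspan by <:].

Definition subspan_norm (v : subspan) : R[i] := `|subspan_val v|.

Lemma subspan_ler_normD (v w : subspan) :
  subspan_norm (v + w) <= subspan_norm v + subspan_norm w.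
Proof. exact: ler_normD. Qed.

Lemma subspan_normrZ (a : R[i]) (v : subspan) :
  subspan_norm (a *: v) = `|a| * subspan_norm v.
Proof. exact: normrZ. Qed.

Lemma subspan_normr0_eq0 (v : subspan) : subspan_norm v = 0 -> v = 0.
Proof. by move=> /normr0_eq0 v0; apply/val_inj. Qed.

HB.instance Definition _ := Lmodule_isNormed.Build R[i] subspan
  subspan_ler_normD subspan_normrZ subspan_normr0_eq0.

Definition subspan_dot (dot : X -> X -> R[i]) (v w : subspan) : R[i] :=
  dot (subspan_val v) (subspan_val w).

Lemma subspan_basis_subproof (k : F) : e (val k) \in finspan_pred.
Proof.
apply/asboolP; exists (fun j => (j == val k)%:R).
rewrite (big_fsetD1 (val k)) ?fsvalP//= eqxx scale1r big1_fset ?addr0// => j.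
by rewrite !inE => /andP[/negbTE ->] _ _; rewrite scale0r.
Qed.

Definition subspan_basis (k : F) : subspan :=
  Subspan (subspan_basis_subproof k).

End FinSpan.

Arguments subspan_dot {R X I} e F dot.
Arguments subspan_basis {R X I} e F.

(* In this section V is one of X, C^m, span {e_k : k \in F}, with its inner
   product [dot] and its orthonormal basis [e].  A function on the open unit
   ball of V is a total function on V of which only the values on the ball
   matter. *)
Section Bloch.
Context {R : realType} {V : normedModType R[i]} {I : Type}.
Variables (dot : V -> V -> R[i]) (e : I -> V).

(* complex Frechet differentiability at every point of the ball *)
Definition holomorphic_ball (Y : normedModType R[i]) (f : V -> Y) : Prop :=
  forall z : V, `|z| < 1 -> differentiable f z.

(* the element of V whose coordinate <g, e_k> is the (complex) partial
   derivative of h along e_k *)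
Definition gradient (h : V -> R[i]^o) (z : V) : V :=
  get [set g : V | forall k, dot g (e k) = 'D_(e k) h z].

Definition dual_norm (Y : normedModType R[i]) (u : {linear Y -> R[i]^o}) :
    \bar R :=
  ereal_sup [set (rnorm (u y))%:E | y in [set y : Y | `|y| <= 1]].

(* 0 is added to the set because there is no u with ||u|| = 1 when Y = 0. *)
Definition gradient_norm (Y : normedModType R[i]) (f : V -> Y) (z : V) :
    \bar R :=
  ereal_sup ([set 0%E] `|`
    [set (rnorm (gradient (u \o f) z))%:E | u in
      [set u : {linear Y -> R[i]^o} | continuous u /\ dual_norm u = 1%E]]).

Variable mu : R -> R.

Definition bloch_seminorm (Y : normedModType R[i]) (f : V -> Y) : \bar R :=
  ereal_sup [set ((mu (rnorm z))%:E * gradient_norm f z)%E |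
             z in [set z : V | `|z| < 1]].

Definition bloch_norm (Y : normedModType R[i]) (f : V -> Y) : \bar R :=
  ((rnorm (f 0%R))%:E + bloch_seminorm f)%E.

Definition bloch_space (Y : normedModType R[i]) : set (V -> Y) :=
  [set f | holomorphic_ball f /\ (bloch_seminorm f < +oo)%E].

End Bloch.

Section Restrictions.
Context {R : realType} {X Y : normedModType R[i]}.

Definition OS (dot : X -> X -> R[i]) (m : nat) : set ('I_m -> X) :=
  [set x | orthonormal_family dot x].

Definition restrict_OS (f : X -> Y) (m : nat) (x : 'I_m -> X) :
    euclid R m -> Y :=
  fun z => f (\sum_(k < m) (z : 'rV[R[i]]_m) 0 k *: x k).

Definition restrict_finspan (f : X -> Y) (I : choiceType) (e : I -> X)
    (F : {fset I}) : subspan e F -> Y :=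
  fun z => f (subspan_val z).

End Restrictions.

Arguments OS {R X} dot m.
Arguments restrict_finspan {R X Y} f {I} e F.

Section RestrictedNorms.
Context {R : realType} {X Y : normedModType R[i]}.
Variables (dot : X -> X -> R[i]) (mu : R -> R) (f : X -> Y).

Definition bloch_seminorm_OS (m : nat) (x : 'I_m -> X) : \bar R :=
  bloch_seminorm (@euclid_dot R m) euclid_basis mu (restrict_OS f x).

Definition bloch_norm_OS (m : nat) (x : 'I_m -> X) : \bar R :=
  bloch_norm (@euclid_dot R m) euclid_basis mu (restrict_OS f x).

Definition bloch_seminorm_finspan (I : choiceType) (e : I -> X)
    (F : {fset I}) : \bar R :=
  bloch_seminorm (subspan_dot e F dot) (subspan_basis e F) mu
    (restrict_finspan f e F).

Definition bloch_norm_finspan (I : choiceType) (e : I -> X)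
    (F : {fset I}) : \bar R :=
  bloch_norm (subspan_dot e F dot) (subspan_basis e F) mu
    (restrict_finspan f e F).

End RestrictedNorms.

(* Main.v *)
(* The gradient represents the derivative of u \o f, so its norm is the operator
   norm, and each of the three seminorms is at most S iff
     mu(|z|) |u (f'(z) v)| <= S |v|
   for all unit functionals u and all z, v in, respectively, the whole space,
   the span of finitely many basis vectors, the span of an orthonormal system.
   A pair z, v lies in the span of an orthonormal system of any order m >= 2,
   which settles the third case.  For the second one the bound has to pass from
   a dense subspace to the closure although f' is not known to be continuous:
   by the mean value theorem on segments of the dense subspace and continuity of
   mu, u \o f is K-Lipschitz near z for every K > S / mu(|z|), and a
   Lipschitz bound does survive in the closure. *)
Require Import Defs.
From HB Require Import structures.
From mathcomp Require Import all_boot all_order all_algebra.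
From mathcomp Require Import sesquilinear spectral finmap complex.
From mathcomp Require Import all_classical all_reals all_analysis.
From mathcomp.analysis.showcase Require Import summability.

Import Order.TTheory GRing.Theory Num.Theory.
Import numFieldNormedType.Exports.

Local Open Scope classical_set_scope.
Local Open Scope ring_scope.

(** * Inner products and real-valued norms *)

Section DotProduct.
Context {R : realType} {X : normedModType R[i]}.
Variable dot : {dot X for Num.conj}.
Hypothesis dotE : forall x : X, dot x x = `|x| ^+ 2.

Lemma dotC (x y : X) : dot x y = (dot y x)^*%R.
Proof. by rewrite hermC expr0 mul1r. Qed.

Lemma dotZl (a : R[i]) (x y : X) : dot (a *: x) y = a * dot x y.
Proof. exact: linearZl_LR. Qed.

Lemma dotZr (a : R[i]) (x y : X) : dot x (a *: y) = a^*%R * dot x y.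
Proof. exact: linearZr_LR. Qed.

Lemma dot_suml (I : Type) (r : seq I) (P : pred I) (c : I -> R[i])
    (e : I -> X) (y : X) :
  dot (\sum_(i <- r | P i) c i *: e i) y =
    \sum_(i <- r | P i) c i * dot (e i) y.
Proof.
elim/big_rec2 : _ => [|i a b _ <-]; first by rewrite linear0l.
by rewrite linearDl/= dotZl.
Qed.

Lemma dot_sumr (I : Type) (r : seq I) (P : pred I) (c : I -> R[i])
    (e : I -> X) (y : X) :
  dot y (\sum_(i <- r | P i) c i *: e i) =
    \sum_(i <- r | P i) (c i)^*%R * dot y (e i).
Proof.
elim/big_rec2 : _ => [|i a b _ <-]; first by rewrite linear0r.
by rewrite linearDr/= dotZr.
Qed.

(** Cauchy-Schwarz: the squared norm of the component of [x] orthogonal to [y] is nonnegative. *)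
Lemma norm_dot_le (x y : X) : `|dot x y| <= `|x| * `|y|.
Proof.
have [->|y0] := eqVneq y 0; first by rewrite linear0r !normr0 mulr0.
have ny0 : 0 < `|y| by rewrite normr_gt0.
rewrite -(@ler_pXn2r _ 2) ?nnegrE ?mulr_ge0// exprMn -ler_pdivrMr ?exprn_gt0//.
have : 0 <= dot (x - (dot x y / dot y y) *: y) (x - (dot x y / dot y y) *: y).
  by rewrite dotE exprn_ge0.
rewrite linearBl/= !linearBr/= !dotZl !dotZr !dotE (dotC y x).
have -> : (dot x y / `|y| ^+ 2)^* = (dot x y)^* / `|y| ^+ 2.
  rewrite rmorphM/= fmorphV/= rmorphXn/=.
  by rewrite (conj_Creal (ger0_real (normr_ge0 y))).
rewrite divfK ?expf_neq0 ?normr_eq0// subrr subr0 subr_ge0.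
by rewrite mulrAC (mulrC _^*) -normCK.
Qed.

Lemma dot_continuousl (y : X) : continuous (fun x : X => dot x y : R[i]^o).
Proof.
move=> x; apply/cvgrPdist_le => eps eps0; near=> t.
rewrite -linearBl (le_trans (norm_dot_le _ _))//.
(* The added 1 keeps the divisor positive when [y = 0]. *)
apply: (@le_trans _ _ (`|x - t| * (`|y| + 1))).
  by rewrite ler_wpM2l// lerDl.
rewrite -ler_pdivlMr ?ltr_wpDl//.
near: t; apply: cvgr_dist_le; last by rewrite divr_gt0 ?ltr_wpDl.
exact: cvg_id.
Unshelve. all: by end_near. Qed.

End DotProduct.

Section RealNorm.
Context {R : realType} {V : normedModType R[i]}.
Implicit Types x y : V.

Lemma rnormE x : `|x| = (rnorm x)%:C%C.
Proof. by rewrite /rnorm RRe_real// ger0_real. Qed.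

Lemma rnorm_ge0 x : 0 <= rnorm x.
Proof. by rewrite -ler0c -rnormE. Qed.

Lemma rnorm_le (r : R) x : (rnorm x <= r) = (`|x| <= r%:C%C).
Proof. by rewrite rnormE lecR. Qed.

Lemma rnorm_lt (r : R) x : (rnorm x < r) = (`|x| < r%:C%C).
Proof. by rewrite rnormE ltcR. Qed.

Lemma rnorm0 : rnorm (0 : V) = 0.
Proof. by rewrite /rnorm normr0. Qed.

Lemma rnorm_eq0 x : (rnorm x == 0) = (x == 0).
Proof. by rewrite -(inj_eq (@complexI R)) -rnormE normr_eq0. Qed.

Lemma rnormN x : rnorm (- x) = rnorm x.
Proof. by rewrite /rnorm normrN. Qed.

Lemma rdistC x y : rnorm (x - y) = rnorm (y - x).
Proof. by rewrite -opprB rnormN. Qed.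

Lemma ler_rnormD x y : rnorm (x + y) <= rnorm x + rnorm y.
Proof. by rewrite rnorm_le rmorphD/= -!rnormE ler_normD. Qed.

Lemma rnormZ (a : R[i]^o) x : rnorm (a *: x) = rnorm a * rnorm x.
Proof. by apply: complexI; rewrite rmorphM/= -!rnormE normrZ. Qed.

Lemma rnormZr (a : R) x : 0 <= a -> rnorm (a%:C%C *: x) = a * rnorm x.
Proof. by move=> a0; rewrite rnormZ /rnorm ger0_norm ?ler0c. Qed.

Lemma ler_rdist x y : `|rnorm x - rnorm y| <= rnorm (x - y).
Proof.
rewrite ler_norml lerBlDr (le_trans _ (ler_rnormD _ _)) ?subrK// andbT.
by rewrite lerNl opprB lerBlDr rdistC (le_trans _ (ler_rnormD _ _)) ?subrK.
Qed.

(** Radii of balls are elements of [R[i]], but a positive element of [R[i]] is real, so real radii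
    give the same neighbourhoods. *)
Lemma nbhs_rnormP x (P : set V) :
  nbhs x P <-> exists2 r : R, 0 < r & forall y, rnorm (x - y) < r -> P y.
Proof.
split=> [/nbhs_normP[r /= r0 xP]|[r r0 xP]].
  have rE : r = (complex.Re r)%:C%C by rewrite RRe_real// gtr0_real.
  exists (complex.Re r); first by rewrite -ltcR -rE.
  by move=> y; rewrite rnorm_lt -rE => xy; apply: xP.
apply/nbhs_normP; exists r%:C%C; first by rewrite /= ltcR.
by move=> y /=; rewrite -rnorm_lt; apply: xP.
Qed.

Lemma rnorm_continuous : continuous (@rnorm R V).
Proof.
move=> x; apply/cvgrPdist_lt => eps eps0; apply/nbhs_rnormP.
by exists eps => // y xy; apply: le_lt_trans (ler_rdist _ _) xy.
Qed.

End RealNorm.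

(** * Gradients and operator norms *)

Section Orthonormal.
Context {R : realType} {V : normedModType R[i]}.
Variable dot : {dot V for Num.conj}.
Hypothesis dotE : forall x : V, dot x x = `|x| ^+ 2.
Context {I : choiceType} {e : I -> V}.
Hypothesis e_orth : orthonormal_family dot e.

Lemma dot_orthonormal_sum (r : seq I) (c : I -> R[i]) (j : I) : uniq r ->
  dot (\sum_(k <- r) c k *: e k) (e j) = if j \in r then c j else 0.
Proof.
move=> r_uniq; rewrite dot_suml; case: ifP => jr.
  rewrite (bigD1_seq j)//= e_orth eqxx mulr1 big1 ?addr0// => k kj.
  by rewrite e_orth (negbTE kj) mulr0.
rewrite big_seq big1// => k kr; rewrite e_orth.
by case: eqP kr => [->|]; rewrite ?jr// mulr0.
Qed.

Lemma rnorm_orthonormal_sum (r : seq I) (c : I -> R[i]) : uniq r ->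
  rnorm (\sum_(k <- r) c k *: e k) ^+ 2 =
    \sum_(k <- r) rnorm (c k : R[i]^o) ^+ 2.
Proof.
move=> r_uniq; apply: complexI; rewrite rmorphXn/= -rnormE -dotE dot_sumr.
rewrite rmorph_sum/= big_seq [RHS]big_seq; apply: eq_bigr => k kr.
rewrite dot_orthonormal_sum// kr rmorphXn/= -rnormE normCK mulrC//.
Qed.

(** By Pythagoras the norm sees only the moduli of the coefficients. This absorbs the conjugation
    appearing in [dot_orthonormal_conj]. *)
Lemma rnorm_orthonormal_conj (r : seq I) (c : I -> R[i]) : uniq r ->
  rnorm (\sum_(k <- r) (c k)^* *: e k) = rnorm (\sum_(k <- r) c k *: e k).
Proof.
move=> r_uniq; apply/eqP; rewrite -(@eqrXn2 _ 2) ?rnorm_ge0//.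
rewrite !rnorm_orthonormal_sum//; apply/eqP/eq_bigr => k _.
by congr (_ ^+ _); rewrite /rnorm norm_conjC.
Qed.

(** The gradient has coordinates [L (e k)], not their conjugates, while [dot] is conjugate-linear on
    the right; hence [g] represents [L] only up to conjugating coordinates. *)
Lemma dot_orthonormal_conj (L : {linear V -> R[i]^o}) (g : V) (r : seq I)
    (c : I -> R[i]) :
  (forall k, dot g (e k) = L (e k)) ->
  dot g (\sum_(k <- r) c k *: e k) = L (\sum_(k <- r) (c k)^* *: e k).
Proof.
move=> gL; rewrite dot_sumr linear_sum; apply: eq_bigr => k _.
by rewrite gL linearZ.
Qed.

Hypothesis e_dense : closure (\bigcup_(F in [set: {fset I}]) finspan e F) = setT.

Lemma finspan_closed_ind (P : set V) : closed P ->
  (forall F v, finspan e F v -> P v) -> forall v, P v.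
Proof.
move=> Pcl FP v; rewrite (closure_id P).1//.
suff : closure (\bigcup_(F in [set: {fset I}]) finspan e F) `<=` closure P.
  by rewrite e_dense; apply.
by apply: closureS => w [F _]; apply: FP.
Qed.

Lemma closed_rnorm_le (U : normedModType R[i]) (h : V -> U) (M : R) :
  continuous h -> closed [set v | rnorm (h v) <= M * rnorm v].
Proof.
move=> hc; rewrite (_ : mkset _ =
  (fun v => M * rnorm v - rnorm (h v)) @^-1` [set x | 0 <= x]).
  apply: closed_comp; last exact: closed_ge.
  move=> v _; apply: cvgB; last exact: (cvg_comp _ _ (hc v) (@rnorm_continuous _ _ _)).
  by apply: cvgMr; exact: rnorm_continuous.
by apply/seteqP; split=> v /=; rewrite subr_ge0.
Qed.

(** One direction is Cauchy-Schwarz on finite sums with conjugated coefficients, the other tests the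
    functional given by [g] at [g] itself. Both bounds are closed conditions, so they extend from
    the finite spans to [V]. *)
Lemma rnorm_gradient_le (L : {linear V -> R[i]^o}) (g : V) (M : R) :
  continuous L -> (forall k, dot g (e k) = L (e k)) -> 0 <= M ->
  rnorm g <= M <-> (forall v, rnorm (L v) <= M * rnorm v).
Proof.
move=> Lc gL M0; split=> [gM|LM].
  apply: finspan_closed_ind; first exact: closed_rnorm_le.
  move=> F _ [c ->]; rewrite -rnorm_orthonormal_conj ?fset_uniq//.
  have := dot_orthonormal_conj _ _ F (fun k => (c k)^*) gL.
  under [X in L X]eq_bigr do rewrite conjCK.
  move=> <-; rewrite rnorm_le rmorphM/= -!rnormE.
  apply: (le_trans (norm_dot_le _ dotE _ _)).
  by rewrite ler_wpM2r// -rnorm_le.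
have gw w : rnorm (dot w g : R[i]^o) <= M * rnorm w.
  move: w; apply: finspan_closed_ind.
    by apply: closed_rnorm_le; exact: dot_continuousl.
  move=> F _ [c ->]; rewrite dotC /rnorm norm_conjC -!/(rnorm _).
  rewrite (dot_orthonormal_conj _ _ _ _ gL).
  by rewrite -rnorm_orthonormal_conj ?fset_uniq//; exact: LM.
(* This reads as a bound of the square of [rnorm g] by [M * rnorm g]; one factor is cancelled once
   [g = 0] is set aside. *)
have := gw g; rewrite {1}/rnorm dotE normrX normr_id rnormE -rmorphXn/= expr2.
have [->//|g0] := eqVneq g 0; first by rewrite rnorm0.
by rewrite ler_pM2r// lt_def rnorm_ge0 rnorm_eq0 g0.
Qed.

End Orthonormal.

(** * Existence of vectors with prescribed coordinates [L (e k)] *)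

Section GradientExistence.
Context {R : realType}.

#[local] Existing Instance totally_filter.

Lemma exists_gradient_fin (V : normedModType R[i]) (dot : {dot V for Num.conj})
    (I : finType) (e : I -> V)
    (e_orth : orthonormal_family dot e) (L : {linear V -> R[i]^o}) :
  exists g, forall k, dot g (e k) = L (e k).
Proof.
exists (\sum_(k <- index_enum I) (L (e k) : R[i]) *: e k) => k.
by rewrite dot_orthonormal_sum ?index_enum_uniq// mem_index_enum.
Qed.

(* Bessel: |g_F|^2 = L(conj g_F) <= M |g_F| for g_F = sum_F L(e_k) e_k, so the
   increasing net |g_F|^2 is bounded, and |g_F - g_A|^2 = |g_F|^2 - |g_A|^2. *)
Lemma exists_gradient (V : completeNormedModType R[i])
    (dot : {dot V for Num.conj}) (dotE : forall x : V, dot x x = `|x| ^+ 2)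
    (I : choiceType) (e : I -> V) (e_orth : orthonormal_family dot e)
    (L : {linear V -> R[i]^o}) :
  continuous L -> exists g, forall k, dot g (e k) = L (e k).
Proof.
move=> Lc.
have [M M0 LM] : exists2 M : R, 0 < M & forall v, rnorm (L v) <= M * rnorm v.
  have [k k0 Lk] := linear_lipschitz Lc.
  exists (complex.Re k).
    by move: k0; rewrite ltcE => /andP[].
  move=> v; rewrite rnorm_le rmorphM/= RRe_real ?gtr0_real// -rnormE.
  exact: Lk.
pose c k : R[i] := L (e k).
pose g (F : {fset I}) := \sum_(k <- F) c k *: e k.
have gM F : rnorm (g F) <= M.
  have LgF : L (\sum_(k <- F) (c k)^* *: e k) = (rnorm (g F) ^+ 2)%:C%C.
    rewrite (rnorm_orthonormal_sum _ dotE e_orth) ?fset_uniq// rmorph_sum/= linear_sum.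
    apply: eq_bigr => k _.
    by rewrite linearZ/= rmorphXn/= -rnormE normCK [LHS]mulrC.
  have := LM (\sum_(k <- F) (c k)^* *: e k).
  rewrite (rnorm_orthonormal_conj _ dotE e_orth) ?fset_uniq// LgF.
  rewrite {1}/rnorm ger0_norm ?ler0c ?exprn_ge0 ?rnorm_ge0//= expr2.
  have [->|gF0] := eqVneq (g F) 0; first by move=> _; rewrite rnorm0 ltW.
  by rewrite ler_pM2r// lt_def rnorm_ge0 rnorm_eq0 gF0.
pose S := [set rnorm (g F) ^+ 2 | F in [set: {fset I}]].
have supS : has_sup S.
  split; first by exists (rnorm (g fset0) ^+ 2), fset0.
  by exists (M ^+ 2) => _ [F _ <-]; rewrite lerXn2r ?nnegrE ?rnorm_ge0 ?gM ?ltW.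
have gcvg : cvg (g F @[F --> totally]).
  apply/cauchy_cvgP/cauchy_exP => eps eps0.
  have eps'0 : 0 < complex.Re eps by move: eps0; rewrite ltcE => /andP[].
  (* [A] brings the squared norm within the square of [eps] of its supremum, so for every [F]
     containing [A] the remainder over [B] has norm below [eps]. *)
  have [_ [A _ <-] SA] := sup_adherent (exprn_gt0 2 eps'0) supS.
  exists (g A); exists A => // F /= AF.
  pose B := [fset k in F | k \notin A]%fset.
  have split_sum (U : nmodType) (h : I -> U) :
      \sum_(k <- F) h k = \sum_(k <- A) h k + \sum_(k <- B) h k.
    rewrite (big_fsetID _ (mem A)) /=; congr (_ + _); apply: eq_fbigl => k.
    by rewrite !inE/=; apply/andP/idP => [[]//|kA]; split=> //; exact: (fsubsetP AF).
  rewrite -ball_normE/= distrC -[eps]RRe_real ?gtr0_real// -rnorm_lt.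
  have -> : g F - g A = g B by rewrite /g split_sum addrAC subrr add0r.
  rewrite -(@ltr_pXn2r _ 2) ?nnegrE ?rnorm_ge0 ?ltW//.
  rewrite -(ltrD2l (rnorm (g A) ^+ 2)).
  have -> : rnorm (g A) ^+ 2 + rnorm (g B) ^+ 2 = rnorm (g F) ^+ 2.
    by rewrite !(rnorm_orthonormal_sum _ dotE e_orth) ?fset_uniq// split_sum.
  rewrite -ltrBlDr; apply: le_lt_trans SA; rewrite lerD2r.
  by apply: ub_le_sup; [exact: supS.2|exists F].
exists (lim (g F @[F --> totally])) => k.
pose d F : R[i]^o := dot (g F) (e k).
have d_lim : d F @[F --> totally] --> (dot (lim (g F @[F --> totally])) (e k) : R[i]^o).
  exact: (cvg_comp _ _ gcvg (dot_continuousl _ dotE (e k) _)).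
(* The coordinate along [e k] is constant as soon as [F] contains [k], so its limit is read off
   there. *)
have d_cst : d F @[F --> totally] --> (L (e k) : R[i]^o).
  apply: cvg_near_cst; exists [fset k]%fset => // F /=.
  by rewrite fsub1set => kF; rewrite /d dot_orthonormal_sum ?fset_uniq// kF.
exact: (cvg_unique _ d_lim d_cst).
Qed.

End GradientExistence.

(** * Seminorm bounds as bounds on directional derivatives *)

Section BlochSeminorm.
Context {R : realType} {V Y : normedModType R[i]}.
Variable dot : {dot V for Num.conj}.
Hypothesis dotE : forall x : V, dot x x = `|x| ^+ 2.
Context {I : choiceType} {e : I -> V}.
Hypothesis e_basis : orthonormal_basis dot e.
(** Left abstract to serve both the complete space [X] and the finite-dimensional spaces. *)
Hypothesis e_gradient : forall L : {linear V -> R[i]^o}, continuous L ->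
  exists g, forall k, dot g (e k) = L (e k).

Lemma rnorm_gradientP (h : V -> R[i]^o) (z : V) (M : R) :
  differentiable h z -> 0 <= M ->
  rnorm (gradient dot e h z) <= M <->
    (forall v, rnorm ('d h z v : R[i]^o) <= M * rnorm v).
Proof.
move=> dh M0; apply: (rnorm_gradient_le _ dotE e_basis.1 e_basis.2) => //.
  exact: diff_continuous.
have [g gE] := e_gradient _ (diff_continuous dh).
move=> k; rewrite -deriveE//.
(* [gradient] is a choice by [get]; it has the required coordinates because [g] witnesses that some
   vector does. *)
have := @getPex _ [set g : V | forall k, dot g (e k) = 'D_(e k) h z].
apply; exists g => j; by rewrite deriveE.
Qed.

Lemma bloch_seminorm_ge0 (mu : R -> R) (f : V -> Y) :
  0 <= mu 0 -> (0 <= bloch_seminorm dot e mu f)%E.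
Proof.
move=> mu0; apply: le_ereal_sup_tmp.
exists ((mu (rnorm (0%R : V)))%:E * gradient_norm dot e f 0%R)%E.
  by exists 0 => //=; rewrite normr0.
rewrite rnorm0 mule_ge0 ?lee_fin//; apply: le_ereal_sup_tmp.
by exists 0%E => //; left.
Qed.

(** The chain rule moves [u] outside the derivative, [rnorm_gradientP] turns the gradient into an
    operator norm, and division by the positive [mu (rnorm z)] isolates it. *)
Lemma bloch_seminorm_leP (mu : R -> R) (f : V -> Y) (S : R) :
  (forall t, 0 <= t < 1 -> 0 < mu t) -> holomorphic_ball f -> 0 <= S ->
  (bloch_seminorm dot e mu f <= S%:E)%E <->
  (forall z, `|z| < 1 -> forall u : {linear Y -> R[i]^o}, continuous u ->
     dual_norm u = 1%E ->
     forall v, mu (rnorm z) * rnorm (u ('d f z v)) <= S * rnorm v).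
Proof.
move=> mu_gt0 fholo S0.
have muz (z : V) : `|z| < 1 -> 0 < mu (rnorm z).
  by move=> z1; rewrite mu_gt0// rnorm_ge0 rnorm_lt.
have Smu (z : V) : `|z| < 1 -> 0 <= S / mu (rnorm z).
  by move=> z1; rewrite divr_ge0// ltW// muz.
have leuf (z : V) (u : {linear Y -> R[i]^o}) : `|z| < 1 -> continuous u ->
    rnorm (gradient dot e (u \o f) z) <= S / mu (rnorm z) <->
    forall v, mu (rnorm z) * rnorm (u ('d f z v)) <= S * rnorm v.
  move=> z1 uc; have udiff := linear_differentiable (f z) uc.
  have ufdiff := differentiable_comp (fholo z z1) udiff.
  have duf v : 'd (u \o f) z v = u ('d f z v).
    by rewrite diff_comp// ?diff_lin//; exact: fholo.
  rewrite (rnorm_gradientP _ _ _ ufdiff (Smu z z1)).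
  by split=> H v; have := H v; rewrite duf mulrAC ler_pdivlMr ?muz// mulrC.
split=> [fS z z1 u uc u1|H].
  apply/leuf => //; rewrite -lee_fin [_ / _]mulrC EFinM lee_pdivlMl ?muz//.
  apply: le_trans fS; apply: le_ereal_sup_tmp.
  exists ((mu (rnorm z))%:E * gradient_norm dot e f z)%E; first by exists z.
  rewrite lee_pmul2l// ?lte_fin ?muz//; apply: ereal_sup_ubound.
  by right; exists u.
apply/ereal_supP => _ [z /= z1 <-]; rewrite -lee_pdivlMl ?muz// -EFinM mulrC.
(* The first case is the 0 adjoined in [gradient_norm], bounded because [S] is nonnegative. *)
apply/ereal_supP => _ [->|[u [uc u1] <-]]; first by rewrite lee_fin Smu.
by rewrite lee_fin; apply/leuf => // v; exact: H.
Qed.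

End BlochSeminorm.

(** * Restrictions to finite-dimensional subspaces *)

Section FiniteBasis.
Context {R : realType}.

Lemma orthonormal_basis_fin (V : normedModType R[i]) (dot : V -> V -> R[i])
    (I : finType) (e : I -> V) :
  orthonormal_family dot e ->
  (forall v, exists c : I -> R[i], v = \sum_i c i *: e i) ->
  orthonormal_basis dot e.
Proof.
move=> e_orth e_span; split=> //; apply/seteqP; split=> // v _.
apply: subset_closure; exists [fset i in I]%fset => //.
have [c ->] := e_span v; exists c; apply: perm_big.
apply: uniq_perm; rewrite ?index_enum_uniq ?fset_uniq// => i.
by rewrite mem_index_enum !inE.
Qed.

Lemma euclid_basis_orthonormal (m : nat) :
  orthonormal_family (@euclid_dot R m) euclid_basis.
Proof.
move=> k j; rewrite /euclid_dot /euclid_basis dotmxE mxE (bigD1 k)//= !mxE !eqxx/=.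
rewrite mul1r big1 ?addr0 => [|i ik]; last by rewrite !mxE (negbTE ik) andbF mul0r.
by rewrite rmorph_nat.
Qed.

Lemma euclid_span (m : nat) (v : euclid R m) :
  v = \sum_(k < m) (v : 'rV[R[i]]_m) 0 k *: (euclid_basis k : euclid R m).
Proof. exact: row_sum_delta. Qed.

Lemma euclid_dotE (m : nat) (v : euclid R m) :
  @euclid_dot R m v v = `|v| ^+ 2.
Proof. by rewrite -[RHS]/(euclid_norm v ^+ 2) sqrtCK. Qed.

Context {X : normedModType R[i]} {Gamma : choiceType}.
Variables (dot : {dot X for Num.conj}) (e : Gamma -> X) (F : {fset Gamma}).
Hypothesis e_orth : orthonormal_family dot e.

Lemma subspan_basis_orthonormal :
  orthonormal_family (subspan_dot e F dot) (subspan_basis e F).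
Proof. by move=> k j; rewrite /subspan_dot/= e_orth. Qed.

Lemma subspan_span (v : subspan e F) :
  exists c : F -> R[i], v = \sum_k c k *: subspan_basis e F k.
Proof.
case: v => v vF; have /asboolP[c vE] := vF.
exists (fun k => c (val k)); apply: val_inj; rewrite linear_sum [LHS]/= vE big_seq_fsetE.
by apply: eq_bigr => k _; rewrite linearZ.
Qed.

End FiniteBasis.

Section SubspanDot.
Context {R : realType} {X : normedModType R[i]} {Gamma : choiceType}.
Variables (dot : {dot X for Num.conj}) (e : Gamma -> X) (F : {fset Gamma}).

Fact subspan_dotDl w : zmod_morphism (subspan_dot e F dot ^~ w).
Proof. by move=> v v'; exact: (linearBl dot (\val w) (\val v) (\val v')). Qed.

Fact subspan_dotDr v : zmod_morphism (subspan_dot e F dot v).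
Proof. by move=> w w'; exact: (linearBr dot (\val v) (\val w) (\val w')). Qed.

Fact subspan_dotZl w : scalable_for *%R (subspan_dot e F dot ^~ w).
Proof. by move=> a v; exact: (dotZl dot a (\val v) (\val w)). Qed.

Fact subspan_dotZr v : scalable_for (Num.conj \; *%R) (subspan_dot e F dot v).
Proof. by move=> a w; exact: (dotZr dot a (\val v) (\val w)). Qed.

HB.instance Definition _ := isBilinear.Build R[i] (subspan e F) (subspan e F)
  R[i] *%R (Num.conj \; *%R) (subspan_dot e F dot)
  subspan_dotDl subspan_dotDr subspan_dotZl subspan_dotZr.

Fact subspan_dot_hermitian v w :
  subspan_dot e F dot v w = (-1) ^+ false * (subspan_dot e F dot w v)^*.
Proof. exact: hermC. Qed.

HB.instance Definition _ := isHermitianSesquilinear.Build R[i] (subspan e F)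
  false Num.conj (subspan_dot e F dot) subspan_dot_hermitian.

Fact subspan_dot_gt0 v : v != 0 -> 0 < subspan_dot e F dot v v.
Proof. by move=> v0; apply: neq0_dnorm_gt0; rewrite -(inj_eq val_inj) in v0. Qed.

HB.instance Definition _ := isDotProduct.Build R[i] (subspan e F)
  (subspan_dot e F dot) subspan_dot_gt0.

End SubspanDot.

HB.instance Definition _ (R : realType) (m : nat) :=
  Dot.copy (@euclid_dot R m) (@dotmx R[i] m).

(** The base point [z] and the direction [v] are kept as a pair: the inequality can then be checked
    inside any subspace containing both. *)
Definition bloch_bound {R : realType} {X Y : normedModType R[i]} (mu : R -> R)
    (f : X -> Y) (S : R) (z v : X) : Prop :=
  forall u : {linear Y -> R[i]^o}, continuous u -> dual_norm u = 1%E ->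
    mu (rnorm z) * rnorm (u ('d f z v)) <= S * rnorm v.

(** * Restriction along a linear isometry *)

Section Isometry.
Context {R : realType} {V X Y : normedModType R[i]}.
Variable iota : {linear V -> X}.
Hypothesis iota_norm : forall v, rnorm (iota v) = rnorm v.

Lemma isometry_continuous : continuous iota.
Proof.
move=> v A /nbhs_rnormP[r r0 vA]; apply/nbhs_rnormP; exists r => // w vw.
by apply: vA; rewrite -linearB iota_norm.
Qed.

Lemma isometry_ball (z : V) : `|z| < 1 -> `|iota z| < 1.
Proof. by rewrite -!rnorm_lt iota_norm. Qed.

Lemma holomorphic_ball_isometry (f : X -> Y) :
  holomorphic_ball f -> holomorphic_ball (f \o iota).
Proof.
move=> fholo z z1; apply: differentiable_comp.
  exact/linear_differentiable/isometry_continuous.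
exact/fholo/isometry_ball.
Qed.

Lemma diff_isometry (f : X -> Y) (z v : V) :
  differentiable f (iota z) -> 'd (f \o iota) z v = 'd f (iota z) (iota v).
Proof.
move=> df; rewrite diff_comp//=; last first.
  exact/linear_differentiable/isometry_continuous.
by rewrite diff_lin//; exact: isometry_continuous.
Qed.

(** The derivative of [f \o iota] is that of [f] at [iota z] composed with [iota]. So the restricted
    seminorm tests exactly the points and directions in the image of [iota], with unchanged norms
    and weights. *)
Lemma bloch_seminorm_isometry_leP (dot : {dot V for Num.conj}) (I : choiceType)
    (e : I -> V) (mu : R -> R) (f : X -> Y) (S : R) :
  (forall x : V, dot x x = `|x| ^+ 2) -> orthonormal_basis dot e ->
  (forall L : {linear V -> R[i]^o}, continuous L ->
    exists g, forall k, dot g (e k) = L (e k)) ->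
  (forall t, 0 <= t < 1 -> 0 < mu t) -> holomorphic_ball f -> 0 <= S ->
  (bloch_seminorm dot e mu (f \o iota) <= S%:E)%E <->
  (forall z v : V, `|z| < 1 -> bloch_bound mu f S (iota z) (iota v)).
Proof.
move=> dotE e_basis e_grad mu_gt0 fholo S0.
rewrite (bloch_seminorm_leP dot dotE e_basis e_grad) //; last first.
  exact: holomorphic_ball_isometry.
have dE z v : `|z| < 1 -> 'd (f \o iota) z v = 'd f (iota z) (iota v).
  by move=> z1; apply/diff_isometry/fholo/isometry_ball.
split=> [H z v z1 u uc u1|H z z1 u uc u1 v].
  by rewrite -dE// !iota_norm; exact: H.
by have := H z v z1 u uc u1; rewrite -dE// !iota_norm.
Qed.

End Isometry.

Section Restrictions.
Context {R : realType} {X Y : normedModType R[i]}.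
Variable dot : {dot X for Num.conj}.
Hypothesis dotE : forall x : X, dot x x = `|x| ^+ 2.
Variables (mu : R -> R) (f : X -> Y).
Hypothesis mu_gt0 : forall t, 0 <= t < 1 -> 0 < mu t.
Hypothesis f_holo : holomorphic_ball f.

Definition euclid_comb (m : nat) (x : 'I_m -> X) (z : euclid R m) : X :=
  \sum_(k < m) (z : 'rV[R[i]]_m) 0 k *: x k.

Fact euclid_comb_linear (m : nat) (x : 'I_m -> X) : linear (euclid_comb m x).
Proof.
move=> a y z; rewrite /euclid_comb scaler_sumr -big_split/=.
by apply: eq_bigr => k _; rewrite !mxE scalerDl scalerA.
Qed.

HB.instance Definition _ (m : nat) (x : 'I_m -> X) :=
  GRing.isLinear.Build R[i] (euclid R m) X _ (euclid_comb m x)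
    (euclid_comb_linear m x).

Lemma rnorm_euclid_comb (m : nat) (x : 'I_m -> X) (z : euclid R m) :
  OS dot m x -> rnorm (euclid_comb m x z) = rnorm z.
Proof.
move=> x_orth; apply/eqP; rewrite -(@eqrXn2 _ 2) ?rnorm_ge0//.
rewrite (rnorm_orthonormal_sum dot dotE x_orth) ?index_enum_uniq//.
rewrite {2}(euclid_span m z) (rnorm_orthonormal_sum _ (euclid_dotE m)
  (euclid_basis_orthonormal m)) ?index_enum_uniq//.
Qed.

Lemma bloch_seminorm_OS_leP (m : nat) (x : 'I_m -> X) (S : R) :
  OS dot m x -> 0 <= S ->
  (bloch_seminorm_OS mu f x <= S%:E)%E <->
  (forall z v : euclid R m, `|z| < 1 ->
    bloch_bound mu f S (euclid_comb m x z) (euclid_comb m x v)).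
Proof.
move=> x_orth S0.
have dE := euclid_dotE (R := R) m.
have bO := euclid_basis_orthonormal (R := R) m.
apply: (bloch_seminorm_isometry_leP (euclid_comb m x) _ (@euclid_dot R m)) => //.
- by move=> v; exact: rnorm_euclid_comb.
- apply: (orthonormal_basis_fin _ _ _ _ bO) => v.
  by exists (fun k => (v : 'rV[R[i]]_m) 0 k); exact: euclid_span.
- by move=> L _; exact: (exists_gradient_fin _ _ _ _ bO).
Qed.

Lemma bloch_seminorm_finspan_leP (I : choiceType) (e : I -> X) (F : {fset I})
    (S : R) :
  orthonormal_family dot e -> 0 <= S ->
  (bloch_seminorm_finspan dot mu f e F <= S%:E)%E <->
  (forall z v : X, finspan e F z -> finspan e F v -> `|z| < 1 ->
    bloch_bound mu f S z v).
Proof.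
move=> e_orth S0.
have dE (v : subspan e F) : subspan_dot e F dot v v = `|v| ^+ 2 by exact: dotE.
have bO := subspan_basis_orthonormal dot e F e_orth.
pose iota : {linear subspan e F -> X} := (\val : subspan e F -> X).
have -> : bloch_seminorm_finspan dot mu f e F =
  bloch_seminorm (subspan_dot e F dot) (subspan_basis e F) mu (f \o iota) by [].
rewrite (bloch_seminorm_isometry_leP iota) //.
- split=> [H z v zF vF z1|H z v z1].
    have zF' : z \in finspan_pred e F by apply/asboolP.
    have vF' : v \in finspan_pred e F by apply/asboolP.
    exact: (H (Subspan zF') (Subspan vF')).
  by apply: H => //; apply/asboolP/subspan_valP.
- exact: (orthonormal_basis_fin _ _ _ _ bO (subspan_span e F)).
- by move=> L _; exact: (exists_gradient_fin _ _ _ _ bO).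
Qed.

End Restrictions.

(** * Gram-Schmidt extension in infinite dimension *)

Section OrthonormalExtension.
Context {R : realType} {X : normedModType R[i]}.
Variable dot : {dot X for Num.conj}.
Hypothesis dotE : forall x : X, dot x x = `|x| ^+ 2.
Hypothesis X_infinite : infinite_dimensional X.

(** Systems are sequences of which only the first [n] terms count, so that enlarging one does not
    change its type. *)
Let orthonormal_upto n (x : nat -> X) :=
  forall i j, (i < n)%N -> (j < n)%N -> dot (x i) (x j) = (i == j)%:R.

Let span_upto n (x : nat -> X) (w : X) :=
  exists c : nat -> R[i], w = \sum_(i < n) c i *: x i.

(** A Gram-Schmidt step. When [w] already lies in the span, infinite dimension supplies another
    vector [w'] to orthonormalise. *)
Lemma orthonormal_extend (n : nat) (x : nat -> X) (w : X) :
  orthonormal_upto n x ->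
  exists2 y, orthonormal_upto n.+1 y &
    span_upto n.+1 y w /\ forall v, span_upto n x v -> span_upto n.+1 y v.
Proof.
move=> x_orth.
have [w' w'x ww'] : exists2 w', ~ span_upto n x w' &
    exists a, exists2 v, span_upto n x v & w = v + a *: w'.
  have [xw|xw] := pselect (span_upto n x w).
    have [y xy] := X_infinite n (fun i => x i).
    exists y; last by exists 0; exists w; rewrite // scale0r addr0.
    by move=> [c yE]; exact: (xy (fun i => c i)).
  exists w => //; exists 1; exists 0; rewrite ?scale1r ?add0r//.
  by exists (fun=> 0); rewrite big1// => i _; rewrite scale0r.
(* [p] is the orthogonal projection of [w'] on the span; the remainder is nonzero since [w'] lies
   outside. *)
pose p := \sum_(i < n) dot w' (x i) *: x i.
have q0 : w' - p != 0.
  apply/eqP => /eqP; rewrite subr_eq0 => /eqP w'p.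
  by apply: w'x; exists (fun i => dot w' (x i)).
pose q := w' - p.
have qx j : (j < n)%N -> dot q (x j) = 0.
  move=> jn; rewrite linearBl/= dot_suml (bigD1 (Ordinal jn))//=.
  rewrite x_orth// eqxx mulr1 big1 ?addr0 ?subrr// => i ij.
  by rewrite x_orth// (_ : (i == j :> nat) = false) ?mulr0//; apply/negbTE.
have [y yx yn] : exists2 y : nat -> X, forall i, (i < n)%N -> y i = x i &
    y n = `|q|^-1 *: q.
  exists (fun i => if (i < n)%N then x i else `|q|^-1 *: q) => [i ->//|].
  by rewrite ltnn.
have sub v : span_upto n x v -> span_upto n.+1 y v.
  move=> [c ->]; exists (fun i => if (i < n)%N then c i else 0).
  rewrite big_ord_recr/= ltnn scale0r addr0; apply: eq_bigr => i _.
  by rewrite ltn_ord yx.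
exists y; last first.
  split=> //; have [a [v [c ->] ->]] := ww'.
  (* These are the coordinates of [v + a *: (p + q)], where [q] is [|q|] times the new unit
     vector. *)
  exists (fun i => if (i < n)%N then c i + a * dot w' (x i) else a * `|q|).
  rewrite big_ord_recr/= ltnn yn scalerA mulfK ?normr_eq0//.
  under [X in _ = X + _]eq_bigr do rewrite ltn_ord yx// scalerDl -scalerA.
  by rewrite big_split/= -scaler_sumr -addrA -scalerDr -/p [p + q]addrC subrK.
move=> i j; rewrite !ltnS => ilen jlen.
have [iltn|nlei] := ltnP i n; have [jltn|nlej] := ltnP j n.
- by rewrite !yx// x_orth.
- have -> : j = n by apply/eqP; rewrite eqn_leq jlen.
  by rewrite yx// yn dotC dotZl qx// mulr0 conjC0 ltn_eqF.
- have -> : i = n by apply/eqP; rewrite eqn_leq ilen.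
  by rewrite yn yx// dotZl qx// mulr0 gtn_eqF.
- have -> : j = n by apply/eqP; rewrite eqn_leq jlen.
  have -> : i = n by apply/eqP; rewrite eqn_leq ilen.
  rewrite yn dotE normrZ normfV normr_id mulVf ?normr_eq0//.
  by rewrite expr1n eqxx.
Qed.

Lemma exists_OS_span2 (m : nat) (z v : X) : (2 <= m)%N ->
  exists2 x, OS dot m x &
    exists z' v' : euclid R m, z = euclid_comb m x z' /\ v = euclid_comb m x v'.
Proof.
move=> m2.
have [x x_orth [[c zE] [d vE]]] : exists2 x, orthonormal_upto m x &
    span_upto m x z /\ span_upto m x v.
  (* For order 2, [z] and then [v] are adjoined to the empty system. Higher orders adjoin 0, which
     only lengthens the system. *)
  elim: m m2 => [//|m IH]; rewrite leq_eqVlt => /orP[/eqP <-|/IH[x x_orth [zx vx]]].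
    have [x0 x0_orth [x0z _]] :=
      orthonormal_extend 0 (fun=> 0) z (fun _ _ => ltac:(by [])).
    have [x x_orth [xv xx0]] := orthonormal_extend _ _ v x0_orth.
    by exists x => //; split=> //; exact: xx0.
  have [y y_orth [_ yx]] := orthonormal_extend _ _ 0 x_orth.
  by exists y => //; split; exact: yx.
exists (fun k => x k); first by move=> i j; rewrite x_orth.
exists (\row_k c k : 'rV_m), (\row_k d k : 'rV_m); split.
  by rewrite zE; apply: eq_bigr => k _; rewrite mxE.
by rewrite vE; apply: eq_bigr => k _; rewrite mxE.
Qed.

End OrthonormalExtension.

(** * Passage from a dense subspace to the whole space *)

Section MeanValue.
Context {R : realType} {X : normedModType R[i]}.

Lemma diff_quotient_cvg (Y : normedModType R[i]) (g : X -> Y) (a v : X) :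
  differentiable g a ->
  k^-1 *: (g (k *: v + a) - g a) @[k --> (0 : (R[i] : numFieldType))^'] --> 'd g a v.
Proof. by move=> dg; rewrite -deriveE//; exact: diff_derivable. Qed.

Lemma Re_le_rnorm (c : R[i]^o) : `|complex.Re c| <= rnorm c.
Proof. by rewrite -lecR -rnormE normc_ge_Re. Qed.

Lemma Re_mull_continuous (c : R[i]) :
  continuous (fun y : R[i]^o => complex.Re (c * y)).
Proof.
move=> y A /nbhs_normP[eps /= eps0 yA]; apply/(@nbhs_rnormP _ R[i]^o).
have c1 : 0 < rnorm (c : R[i]^o) + 1 by rewrite ltr_wpDl// rnorm_ge0.
exists (eps / (rnorm (c : R[i]^o) + 1)); first by rewrite divr_gt0.
move=> x; rewrite ltr_pdivlMr// => yx; apply: yA => /=.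
rewrite -raddfB/= -mulrBr (le_lt_trans (Re_le_rnorm _))//.
rewrite -[c * _]/((c : R[i]^o) *: (y - x)) rnormZ mulrC.
by apply: le_lt_trans yx; rewrite ler_wpM2l ?rnorm_ge0// lerDl.
Qed.

(** Allows a complex difference quotient to be restricted to real increments. *)
Lemma real_complex_cvg_dnbhs0 :
  (h%:C%C : R[i]) @[h --> (0 : R)^'] --> (0 : (R[i] : numFieldType))^'.
Proof.
move=> A /(@nbhs_rnormP _ R[i]^o)[r r0 rA].
apply/nbhs_normP; exists r => // h /=; rewrite sub0r normrN => hr h0.
apply: rA; last by rewrite fmorph_eq0.
by rewrite sub0r rnormN rnorm_lt normc_def/= expr0n/= addr0 sqrtr_sqr ltcR.
Qed.

(** The complex difference quotient along [d], taken at real increments, is pushed through the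
    continuous real-linear map [y] to [Re (c * y)]. *)
Lemma is_derive_Re_line (g : X -> R[i]^o) (w d : X) (c : R[i]) (t : R) :
  differentiable g (w + t%:C%C *: d) ->
  is_derive t (1 : R) (fun s => complex.Re (c * g (w + s%:C%C *: d)))
    (complex.Re (c * 'd g (w + t%:C%C *: d) d)).
Proof.
set a := w + _; set phi := fun s : R => _ => dg.
have quot_lim : h^-1 *: ((phi \o shift t) (h *: (1 : R)) - phi t) @[h --> (0 : R)^'] -->
    complex.Re (c * 'd g a d).
  have := cvg_comp _ _ (cvg_comp _ _ real_complex_cvg_dnbhs0 (diff_quotient_cvg _ _ _ d dg))
    (Re_mull_continuous c _).
  apply: cvg_trans; apply: near_eq_cvg; near=> h => /=.
  have -> : g (h%:C%C *: d + a) = g (w + (h *: 1 + t)%:C%C *: d).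
    by rewrite /a addrCA -scalerDl [h *: 1]mulr1 rmorphD.
  rewrite /phi -raddfB/= -mulrBr -fmorphV -[_ *: (_ - _)]/(_ * (_ - _)) mulrCA.
  by case: (c * _) => x y /=; rewrite mul0r subr0.
apply: DeriveDef; first exact: cvgP quot_lim.
exact: cvg_lim quot_lim.
Unshelve. all: by end_near. Qed.

(* The mean value theorem is applied to the real function Re (conj D * g) on
   the segment, where D is the total increment of g. *)
Lemma mean_value_rnorm (g : X -> R[i]^o) (w d : X) (K : R) :
  (forall t : R, 0 <= t <= 1 -> differentiable g (w + t%:C%C *: d)) ->
  (forall t : R, 0 <= t <= 1 -> rnorm ('d g (w + t%:C%C *: d) d : R[i]^o) <= K) ->
  rnorm (g (w + d) - g w) <= K.
Proof.
move=> dg gK; pose D : R[i] := g (w + d) - g w.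
pose phi s : R := complex.Re (D^* * g (w + s%:C%C *: d)).
pose dphi s : R := complex.Re (D^* * 'd g (w + s%:C%C *: d) d).
have phi_derive (t : R) : 0 <= t <= 1 -> is_derive t (1 : R) phi (dphi t).
  by move=> t01; apply/is_derive_Re_line/dg.
have [||t t01] := @MVT_segment R phi dphi 0 1 ler01.
- by move=> t /[!in_itv]/= /andP[t0 t1]; apply: phi_derive; rewrite !ltW.
- apply: derivable_within_continuous => t /[!in_itv]/= t01.
  by have [] := phi_derive t t01.
rewrite subr0 mulr1 /phi -raddfB/= -mulrBr scale1r scale0r addr0 -/D.
rewrite [D^* * D]mulrC -normCK => phiE.
have D2 : rnorm (D : R[i]^o) ^+ 2 = dphi t.
  by rewrite -phiE (rnormE (D : R[i]^o)) -rmorphXn.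
have : rnorm (D : R[i]^o) ^+ 2 <= rnorm (D : R[i]^o) * K.
  rewrite D2; apply: le_trans (ler_norm _) _.
  apply: le_trans (Re_le_rnorm _) _.
  rewrite -[_ * _]/((D^* : R[i]^o) *: _) rnormZ.
  have -> : rnorm (D^* : R[i]^o) = rnorm (D : R[i]^o) by rewrite /rnorm norm_conjC.
  by rewrite ler_wpM2l ?rnorm_ge0//; apply: gK; rewrite in_itv in t01.
rewrite expr2.
(* No factor can be cancelled if [D = 0]; then [0 <= K] is what remains, and the bound at [t = 0]
   gives it. *)
have [->|D0] := eqVneq (D : R[i]^o) 0.
  move=> _; rewrite rnorm0; apply: le_trans (rnorm_ge0 _) (gK 0 _).
  by rewrite lexx ler01.
by rewrite ler_pM2l// lt_def rnorm_ge0 rnorm_eq0 D0.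
Qed.

End MeanValue.

(** * Lipschitz bounds through density *)

Section DenseSubspace.
Context {R : realType} {X : normedModType R[i]} {I : choiceType} {e : I -> X}.
Hypothesis e_dense : closure (\bigcup_(F in [set: {fset I}]) finspan e F) = setT.

Lemma finspan_fsubset (F G : {fset I}) : (F `<=` G)%fset ->
  finspan e F `<=` finspan e G.
Proof.
move=> FG _ [c ->]; exists (fun k => if k \in F then c k else 0).
rewrite (big_fsetID _ (mem F) G)/= [X in _ + X]big1_fset ?addr0; last first.
  by move=> k; rewrite !inE/= => /andP[_ /negbTE ->]; rewrite scale0r.
have -> : [fset k in G | k \in F]%fset = F.
  apply/fsetP => k; rewrite !inE/=.
  by apply/andP/idP => [[]//|kF]; split=> //; exact: (fsubsetP FG).
by apply: eq_big_seq => k kF; rewrite kF.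
Qed.

Lemma finspan_linear (F : {fset I}) (a : R[i]) (v w : X) :
  finspan e F v -> finspan e F w -> finspan e F (a *: v + w).
Proof.
move=> /asboolP vF /asboolP wF; apply/asboolP.
exact: (finspan_submod e F).2.
Qed.

(** A negative value at [p] would persist on a neighbourhood of [p] inside the ball, and that
    neighbourhood meets some finite span. *)
Lemma dense_ball_ge0 (Phi : X -> R) (z p : X) (delta : R) :
  {for p, continuous Phi} -> rnorm (z - p) < delta ->
  (forall F w, finspan e F w -> rnorm (z - w) < delta -> 0 <= Phi w) ->
  0 <= Phi p.
Proof.
move=> Phic zp FPhi; rewrite leNgt; apply/negP => Phip.
have : closure (\bigcup_(F in [set: {fset I}]) finspan e F) p by rewrite e_dense.
move=> /(_ [set w | Phi w < 0 /\ rnorm (z - w) < delta])[].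
  apply: filterI; first exact: (cvgr_lt (Phi p)).
  apply/nbhs_rnormP; exists (delta - rnorm (z - p)); first by rewrite subr_gt0.
  move=> w; rewrite ltrBrDl; apply: le_lt_trans.
  by rewrite (le_trans _ (ler_rnormD _ _))// addrA subrK.
by move=> w [[F _ wF] [+ zw]]; rewrite ltNge (FPhi F).
Qed.

(** The mean value inequality handles two endpoints in a common finite span; density then frees the
    endpoints one at a time, so only continuity of [g] is used in the limit. *)
Lemma dense_Lipschitz (g : X -> R[i]^o) (z : X) (delta K : R) :
  (forall w, rnorm (z - w) < delta -> differentiable g w) ->
  (forall F w d, finspan e F w -> finspan e F d -> rnorm (z - w) < delta ->
    rnorm ('d g w d : R[i]^o) <= K * rnorm d) ->
  forall w1 w2, rnorm (z - w1) < delta -> rnorm (z - w2) < delta ->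
    rnorm (g w2 - g w1) <= K * rnorm (w2 - w1).
Proof.
move=> dg gK.
have segment F w1 w2 : finspan e F w1 -> finspan e F w2 ->
    rnorm (z - w1) < delta -> rnorm (z - w2) < delta ->
    rnorm (g w2 - g w1) <= K * rnorm (w2 - w1).
  move=> w1F w2F zw1 zw2.
  have dF : finspan e F (w2 - w1).
    by rewrite addrC -scaleN1r; exact: finspan_linear.
  have in_ball (t : R) : 0 <= t <= 1 -> rnorm (z - (w1 + t%:C%C *: (w2 - w1))) < delta.
    move=> /andP[t0 t1].
    have -> : z - (w1 + t%:C%C *: (w2 - w1)) =
        (1 - t)%:C%C *: (z - w1) + t%:C%C *: (z - w2).
      rewrite rmorphB/= scalerBl scale1r -addrA [- _ + _]addrC -scalerBr.
      have -> : z - w2 - (z - w1) = - (w2 - w1).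
        by rewrite !opprB addrC addrA subrK.
      by rewrite scalerN opprD addrA.
    rewrite (le_lt_trans (ler_rnormD _ _))// !rnormZr ?subr_ge0//.
    (* For [t > 0] the strict inequality comes from the [w2] term, which vanishes at [t = 0]. *)
    have [->|tn0] := eqVneq t 0; first by rewrite subr0 mul1r mul0r addr0.
    rewrite -[ltRHS]mul1r -[X in X * delta](subrK t) [ltRHS]mulrDl.
    rewrite ler_ltD//; first by rewrite ler_wpM2l ?subr_ge0// ltW.
    by rewrite ltr_pM2l// lt_def tn0.
  have := @mean_value_rnorm R X g w1 (w2 - w1) (K * rnorm (w2 - w1)).
  have -> : w1 + (w2 - w1) = w2 by rewrite addrC subrK.
  apply=> t t01; first exact/dg/in_ball.
  apply: (gK F) => //; last exact: in_ball.
  by rewrite addrC; exact: finspan_linear.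
have Phi_cts w1 w2 : rnorm (z - w2) < delta ->
    {for w2, continuous (fun w => K * rnorm (w - w1) - rnorm (g w - g w1))}.
  move=> zw2.
  have d_cvg : (w - w1) @[w --> w2] --> w2 - w1.
    by apply: cvgB; [exact: cvg_id|exact: cvg_cst].
  have gd_cvg : (g w - g w1) @[w --> w2] --> g w2 - g w1.
    by apply: cvgB; [exact/differentiable_continuous/dg|exact: cvg_cst].
  have dist_cvg := cvg_comp _ _ d_cvg (@rnorm_continuous _ _ (w2 - w1)).
  have gdist_cvg := cvg_comp _ _ gd_cvg (@rnorm_continuous _ _ (g w2 - g w1)).
  by apply: cvgB => //; exact: cvgMr.
have half F w1 w2 : finspan e F w1 -> rnorm (z - w1) < delta ->
    rnorm (z - w2) < delta -> rnorm (g w2 - g w1) <= K * rnorm (w2 - w1).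
  move=> w1F zw1 zw2; rewrite -subr_ge0.
  apply: (dense_ball_ge0 _ z w2 delta (Phi_cts w1 w2 zw2)) => // G w wG zw.
  (* Finite spans are directed: the span over the union contains both endpoints. *)
  rewrite subr_ge0; apply: (segment (F `|` G)%fset) => //.
    by apply: finspan_fsubset w1F; exact: fsubsetUl.
  by apply: finspan_fsubset wG; exact: fsubsetUr.
move=> w1 w2 zw1 zw2; rewrite rdistC (rdistC w2) -subr_ge0.
apply: (dense_ball_ge0 _ z w1 delta (Phi_cts w2 w1 zw1)) => // G w wG zw.
by rewrite subr_ge0 rdistC (rdistC w); exact: (half G).
Qed.

(** The derivative is a limit of difference quotients, each bounded by [K * rnorm v] once the
    increment stays in the ball. *)
Lemma diff_le_Lipschitz (g : X -> R[i]^o) (z v : X) (delta K : R) :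
  0 < delta -> differentiable g z ->
  (forall w, rnorm (z - w) < delta -> rnorm (g w - g z) <= K * rnorm (w - z)) ->
  rnorm ('d g z v : R[i]^o) <= K * rnorm v.
Proof.
move=> delta0 dg gK.
have := cvg_comp _ _ (diff_quotient_cvg _ _ _ v dg)
  (@rnorm_continuous R R[i]^o ('d g z v)).
move=> /cvgr_to_le; apply.
have v1 : 0 < rnorm v + 1 by rewrite ltr_wpDl// rnorm_ge0.
apply/(@nbhs_rnormP _ R[i]^o); exists (delta / (rnorm v + 1)); first by rewrite divr_gt0.
move=> k; rewrite sub0r rnormN ltr_pdivlMr// => kdelta k0 /=.
have kn0 : 0 < rnorm (k : R[i]^o) by rewrite lt_def rnorm_ge0 rnorm_eq0 k0.
rewrite rnormZ.
have -> : rnorm (k^-1 : R[i]^o) = (rnorm (k : R[i]^o))^-1.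
  by apply: complexI; rewrite fmorphV/= -!rnormE normfV.
rewrite mulrC ler_pdivrMr//.
have := gK (k *: v + z).
rewrite addrK opprD addrCA subrr addr0 rnormN rnormZ mulrAC mulrA; apply.
by apply: le_lt_trans kdelta; rewrite ler_wpM2l ?rnorm_ge0// lerDl.
Qed.

Lemma bloch_bound_dense (Y : normedModType R[i]) (mu : R -> R) (f : X -> Y)
    (S : R) :
  (forall t, 0 <= t < 1 -> 0 < mu t) -> {within `[0, 1[, continuous mu} ->
  holomorphic_ball f -> 0 <= S ->
  (forall F z v, finspan e F z -> finspan e F v -> `|z| < 1 ->
    bloch_bound mu f S z v) ->
  forall z v, `|z| < 1 -> bloch_bound mu f S z v.
Proof.
move=> mu_gt0 mu_cts fholo S0 H z v z1 u uc u1.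
have rz1 : rnorm z < 1 by rewrite rnorm_lt.
have muz : 0 < mu (rnorm z) by rewrite mu_gt0// rnorm_ge0.
have near_ball : \forall w \near z, rnorm w < 1.
  exact: (cvgr_lt _ (@rnorm_continuous _ _ z) _ rz1).
pose g : X -> R[i]^o := u \o f.
have dg (w : X) : `|w| < 1 -> differentiable g w.
  move=> w1; apply: differentiable_comp; first exact: fholo.
  exact: linear_differentiable.
have dgE (w d : X) : `|w| < 1 -> 'd g w d = u ('d f w d).
  move=> w1; have udiff := linear_differentiable (f w) uc.
  by rewrite diff_comp// ?diff_lin//; exact: fholo.
rewrite -dgE//.
(* The strict inequality leaves room: by continuity of [mu], [S <= K * mu (rnorm w)] for all [w]
   near [z], so [K] bounds the derivative on the finite spans there. *)
have gK K : S / mu (rnorm z) < K -> rnorm ('d g z v : R[i]^o) <= K * rnorm v.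
  rewrite ltr_pdivrMr// => SK.
  have [delta delta0 zdelta] : exists2 delta, 0 < delta &
      forall w, rnorm (z - w) < delta -> `|w| < 1 /\ S <= K * mu (rnorm w).
    apply/nbhs_rnormP.
    have t01 : `[0, 1[%classic (rnorm z) by rewrite /= in_itv/= rnorm_ge0.
    have mu_cvg := (subspace_continuousP _ _).1 mu_cts _ t01.
    have Kmu : K * mu t @[t --> within `[0, 1[ (nbhs (rnorm z))] --> K * mu (rnorm z).
      exact: cvgMr.
    have near_mu : \forall w \near z, `[0, 1[%classic (rnorm w) -> S < K * mu (rnorm w).
      exact: (@rnorm_continuous _ _ z _ (cvgr_gt _ Kmu _ SK)).
    apply: filterS (filterI near_ball near_mu) => w [w1 Sw].
    by rewrite -rnorm_lt; split=> //; apply/ltW/Sw; rewrite /= in_itv/= rnorm_ge0.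
  apply: (diff_le_Lipschitz g z v delta) => // [|w zw]; first exact: dg.
  apply: (dense_Lipschitz g z delta K) => // [w' /zdelta[w'1 _]||].
  - exact: dg.
  - move=> F w' d w'F dF /zdelta[w'1 SKw'].
    have muw' : 0 < mu (rnorm w') by rewrite mu_gt0// rnorm_ge0 rnorm_lt.
    rewrite -(ler_pM2l muw') dgE//.
    apply: le_trans (H F w' d w'F dF w'1 u uc u1) _.
    by rewrite mulrA ler_wpM2r ?rnorm_ge0// mulrC.
  - by rewrite subrr rnorm0.
have [->|v0] := eqVneq v 0; first by rewrite linear0 !rnorm0 !mulr0.
have vn0 : 0 < rnorm v by rewrite lt_def rnorm_ge0 rnorm_eq0 v0.
(* Now [K] decreases to [S / mu (rnorm z)]. *)
rewrite -ler_pdivlMl// mulrA -ler_pdivrMr//; apply/ler_addgt0Pr => eps eps0.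
by rewrite ler_pdivrMr// gK// mulrC ltrDl.
Qed.

End DenseSubspace.

(** * Comparison of the three seminorms *)

Section ExtendedReals.
Context {R : realType}.
Local Open Scope ereal_scope.

(** A finite nonnegative value is itself an admissible [S], and an infinite one bounds everything;
    so real nonnegative bounds determine the value. *)
Lemma eq_ge0_bounds (x y : \bar R) : 0 <= x -> 0 <= y ->
  (forall S : R, (0 <= S)%R -> x <= S%:E <-> y <= S%:E) -> x = y.
Proof.
have half a b : 0 <= b -> (forall S : R, (0 <= S)%R -> b <= S%:E -> a <= S%:E) -> a <= b.
  by case: b => [b|_ _|//]; [rewrite lee_fin => b0; exact|exact: leey].
move=> x0 y0 xy; apply/le_anti/andP; split.
  by apply: half => // S S0 /xy; exact.
by apply: half => // S S0 /xy; exact.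
Qed.

Lemma lt_pinftyP (x : \bar R) : x < +oo <-> exists S : R, x <= S%:E.
Proof.
split=> [|[S xS]]; last exact: le_lt_trans xS (ltry _).
case: x => [x _||_]; [by exists x|by rewrite ltxx|].
by exists 0%R; exact: leNye.
Qed.

(** Serves to pass between norms and seminorms: all restrictions share the value [f 0] at the
    origin, so the two differ by one finite constant. *)
Lemma ereal_sup_addl_ltoo (T : Type) (P : set T) (c : R) (g h : T -> \bar R) :
  (forall x, P x -> h x = c%:E + g x) ->
  ereal_sup [set h x | x in P] < +oo <-> ereal_sup [set g x | x in P] < +oo.
Proof.
move=> hE; rewrite !lt_pinftyP; split=> -[S /ereal_supP PS].
  exists (S - c)%R; apply/ereal_supP => _ [x Px <-].
  by rewrite EFinB leeBrDl// -hE//; apply: PS; exists x.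
exists (c + S)%R; apply/ereal_supP => _ [x Px <-].
by rewrite hE// EFinD leeD2l//; apply: PS; exists x.
Qed.

End ExtendedReals.

Theorem proposition4p1 (R : realType) (X : completeNormedModType R[i])
    (dot : {dot X for Num.conj}) (dotE : forall x : X, dot x x = `|x| ^+ 2)
    (X_infinite : infinite_dimensional X)
    (Gamma : choiceType) (e : Gamma -> X) (e_basis : orthonormal_basis dot e)
    (Y : completeNormedModType R[i])
    (mu : R -> R) (mu_normal : normal_weight mu)
    (f : X -> Y) (f_holo : holomorphic_ball f) :
  [<-> bloch_space dot e mu f;
       (ereal_sup [set bloch_norm_finspan dot mu f e F | F in [set: {fset Gamma}]]
          < +oo)%E;
       forall m : nat, (2 <= m)%N ->
         (ereal_sup [set bloch_norm_OS mu f x | x in OS dot m] < +oo)%E;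
       exists m : nat, (2 <= m)%N /\
         (ereal_sup [set bloch_norm_OS mu f x | x in OS dot m] < +oo)%E]
  /\
  (forall m : nat, (2 <= m)%N ->
     bloch_seminorm dot e mu f =
       ereal_sup [set bloch_seminorm_finspan dot mu f e F |
                  F in [set: {fset Gamma}]]
     /\
     ereal_sup [set bloch_seminorm_finspan dot mu f e F |
                F in [set: {fset Gamma}]] =
       ereal_sup [set bloch_seminorm_OS mu f x | x in OS dot m]).
Proof.
have [mu_gt0 mu_cts _] := mu_normal.
have [e_orth e_dense] := e_basis.
have mu0 : 0 <= mu 0 by rewrite ltW// mu_gt0// lexx ltr01.
pose A := bloch_seminorm dot e mu f.
pose B := ereal_sup [set bloch_seminorm_finspan dot mu f e F |
  F in [set: {fset Gamma}]].
pose C m := ereal_sup [set bloch_seminorm_OS mu f x | x in OS dot m].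
have A_leP S : 0 <= S ->
    (A <= S%:E)%E <-> forall z v : X, `|z| < 1 -> bloch_bound mu f S z v.
  move=> S0; rewrite (bloch_seminorm_leP dot dotE e_basis)//; last first.
    by move=> L; exact: exists_gradient.
  by split=> [H z v z1 u uc u1|H z z1 u uc u1 v]; exact: H.
have AB : A = B.
  apply: eq_ge0_bounds; first exact: bloch_seminorm_ge0.
    (* The empty set suffices to make the supremum nonnegative. *)
    apply: le_ereal_sup_tmp; exists (bloch_seminorm_finspan dot mu f e fset0).
      by exists fset0.
    exact: bloch_seminorm_ge0.
  move=> S S0; rewrite A_leP//; split=> [H|/ereal_supP H].
    apply/ereal_supP => _ [F _ <-].
    by apply/bloch_seminorm_finspan_leP => // z v _ _; exact: H.
  apply: (bloch_bound_dense e_dense) => // F.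
  by apply/(bloch_seminorm_finspan_leP dot dotE) => //; apply: H; exists F.
have AC m : (2 <= m)%N -> A = C m.
  move=> m2; apply: eq_ge0_bounds; first exact: bloch_seminorm_ge0.
    (* Applied to the pair 0, 0 only to know that an orthonormal system of order [m] exists. *)
    have [x xOS _] := exists_OS_span2 dot dotE X_infinite m 0 0 m2.
    apply: le_ereal_sup_tmp; exists (bloch_seminorm_OS mu f x); first by exists x.
    exact: bloch_seminorm_ge0.
  move=> S S0; rewrite A_leP//; split=> [H|/ereal_supP H].
    apply/ereal_supP => _ [x xOS <-].
    apply/(bloch_seminorm_OS_leP dot dotE) => // z v z1; apply: H.
    by rewrite -rnorm_lt (rnorm_euclid_comb dot dotE)// rnorm_lt.
  (* The system is chosen to fit the given pair, so one restriction already contains the inequality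
     wanted. *)
  move=> z v z1; have [x xOS [z' [v' [zE vE]]]] :=
    exists_OS_span2 dot dotE X_infinite m z v m2.
  have /(bloch_seminorm_OS_leP dot dotE _ _ mu_gt0 f_holo _ _ _ xOS S0) Hx :
    (bloch_seminorm_OS mu f x <= S%:E)%E by apply: H; exists x.
  rewrite zE vE; apply: Hx.
  by rewrite -rnorm_lt -(rnorm_euclid_comb dot dotE _ _ _ xOS) -zE rnorm_lt.
have B_norm : (ereal_sup [set bloch_norm_finspan dot mu f e F |
    F in [set: {fset Gamma}]] < +oo)%E <-> (A < +oo)%E.
  rewrite AB; apply: (@ereal_sup_addl_ltoo _ _ _ (rnorm (f 0))) => F _.
  by [].
have C_norm m : (2 <= m)%N -> (ereal_sup [set bloch_norm_OS mu f x |
    x in OS dot m] < +oo)%E <-> (A < +oo)%E.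
  move=> /AC ->; apply: (@ereal_sup_addl_ltoo _ _ _ (rnorm (f 0))) => x _.
  by congr ((rnorm (f _))%:E + _)%E; exact: (linear0 (euclid_comb m x)).
split; last by move=> m m2; rewrite -/A -/B -AB -/(C m) -AC.
(* Since [f] is holomorphic by assumption, each of the four conditions amounts to finiteness of
   [A]. *)
tfae.
- by move=> [_ Afin]; apply/B_norm.
- by move=> /B_norm Afin m m2; apply/C_norm.
- by move=> H; exists 2%N; split=> //; exact: H.
- by move=> [m [m2 /(C_norm m m2) Afin]]; split.
Qed.
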